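(* In scheme (G) of the context choose $\bar\lambda_{k+1}=\lambda_k+\frac{\alpha_k}{\theta_k}(Av_k+Bw_k-b)$. Then (G) becomes the following algorithm: $$\begin{cases}\bar\lambda_{k+1}=\lambda_k+\frac{\alpha_k}{\theta_k}(Av_k+Bw_k-b),\\ x_{k+1}=\operatorname{prox}^{\mathcal X}_{s_kf}(\widetilde x_k-s_kA^\top\bar\lambda_{k+1}),\quad s_k=\alpha_k^2/\eta_{f,k},\\ v_{k+1}=x_{k+1}+(x_{k+1}-x_k)/\alpha_k,\\ y_{k+1}=\operatorname{prox}^{\mathcal Y}_{\tau_kg}(\widetilde y_k-\tau_kB^\top\bar\lambda_{k+1}),\quad\tau_k=\alpha_k^2/\eta_{g,k},\\ w_{k+1}=y_{k+1}+(y_{k+1}-y_k)/\alpha_k,\\ \lambda_{k+1}=\lambda_k+\frac{\alpha_k}{\theta_k}(Av_{k+1}+Bw_{k+1}-b).\end{cases}$$ Assume $f\in\mathcal S^0_{\mu_f}(\mathcal X)$, $g\in\mathcal S^0_{\mu_g}(\mathcal Y)$ with $\mu_f,\mu_g\ge0$, that $\gamma_0=\mu_f$ if $\mu_f>0$ and $\beta_0=\mu_g$ if $\mu_g>0$, and that the step sizes satisfy, for all $k$, $$2\alpha_k^2(\beta_k\|A\|^2+\gamma_k\|B\|^2)=\gamma_k\beta_k\theta_k .$$ Then $\{(x_k,y_k)\}_{k\ge1}\subset\mathcal X\times\mathcal Y$ and $\mathcal E_{k+1}-\mathcal E_k\le-\alpha_k\mathcal E_{k+1}$ for all $k$. Moreover,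 if $\gamma_0\beta_0\le2\beta_0\|A\|^2+2\gamma_0\|B\|^2$, then $$\|Ax_k+By_k-b\|\le\theta_k\mathcal R_0,\qquad \mathcal L(x_k,y_k,\lambda^* )-\mathcal L(x^*,y^*,\lambda_k)\le\theta_k\mathcal E_0,\qquad |F(x_k,y_k)-F^*|\le\theta_k(\mathcal E_0+\|\lambda^*\|\mathcal R_0),$$ where $\mathcal R_0=\sqrt{2\mathcal E_0}+\|\lambda_0-\lambda^*\|+\|Ax_0+By_0-b\|$, and, for all $k\ge1$, $$\theta_k\le C\left(\min\left\{\frac{\|A\|}{\sqrt{\gamma_0}\,k},\ \frac{\|A\|^2}{\mu_fk^2}\right\}+\min\left\{\frac{\|B\|}{\sqrt{\beta_0}\,k},\ \frac{\|B\|^2}{\mu_gk^2}\right\}\right)$$ with a constant $C>0$ independent of $k$, $A$, $B$, $\mu_f$, $\mu_g$, $\gamma_0$ and $\beta_0$.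
   Context: Setting. $\mathcal X\subset\mathbb R^m$, $\mathcal Y\subset\mathbb R^n$ are closed convex sets, $A\in\mathbb R^{r\times m}$, $B\in\mathbb R^{r\times n}$, $b\in\mathbb R^r$, and $f:\mathbb R^m\to\mathbb R\cup\{+\infty\}$, $g:\mathbb R^n\to\mathbb R\cup\{+\infty\}$ are proper closed convex. The problem is to minimize $F(x,y)=f(x)+g(y)$ over $x\in\mathcal X,y\in\mathcal Y$ subject to $Ax+By=b$. $\mathcal L(x,y,\lambda)=F(x,y)+\delta_{\mathcal X\times\mathcal Y}(x,y)+\langle\lambda,Ax+By-b\rangle$ ($\delta$: indicator function). $(x^*,y^*,\lambda^* )\in\mathcal X\times\mathcal Y\times\mathbb R^r$ is a saddle point of $\mathcal L$ (assumed to exist): $\mathcal L(x^*,y^*,\lambda)\le\mathcal L(x^*,y^*,\lambda^* )\le\mathcal L(x,y,\lambda^* )$ for all $(x,y,\lambda)$; $F^*=F(x^*,y^* )$. Norms are Euclidean, and $\|A\|,\|B\|$ are the induced operator norms. $f\in\mathcal S^0_\mu(\mathcal X)$ means $f(x_1)-f(x_2)-\langle p,x_1-x_2\rangle\ge\frac\mu2\|x_1-x_2\|^2$ for all $x_1,x_2\in\mathcal X$, $p\in\partial f(x_2)$; $\mathcal S^0_\mu(\mathcal Y)$ is analogous. $\operatorname{prox}^{\mathcal X}_{sf}(z)=\operatorname{argmin}_{x\in\mathcal X}\{f(x)+\frac1{2s}\|x-z\|^2\}$, and similarly $\operatorname{prox}^{\mathcal Y}_{\tau g}$. Parameters. $\theta_0=1$,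 $\gamma_0>0$, $\beta_0>0$, step sizes $\alpha_k>0$, and $$\frac{\theta_{k+1}-\theta_k}{\alpha_k}=-\theta_{k+1},\quad\frac{\gamma_{k+1}-\gamma_k}{\alpha_k}=\mu_f-\gamma_{k+1},\quad\frac{\beta_{k+1}-\beta_k}{\alpha_k}=\mu_g-\beta_{k+1}.$$ $\eta_{f,k}=(\alpha_k+1)\gamma_k+\mu_f\alpha_k$, $\eta_{g,k}=(\alpha_k+1)\beta_k+\mu_g\alpha_k$, $\widetilde x_k=x_k+\frac{\alpha_k\gamma_k}{\eta_{f,k}}(v_k-x_k)$, $\widetilde y_k=y_k+\frac{\alpha_k\beta_k}{\eta_{g,k}}(w_k-y_k)$. Scheme (G), from an initial guess $(x_0,v_0,y_0,w_0,\lambda_0)$; it is implicit, with the value $\bar\lambda_{k+1}$ (to be chosen) treated as a fixed vector inside the argmins: $$\begin{cases}v_{k+1}=x_{k+1}+(x_{k+1}-x_k)/\alpha_k,\\ x_{k+1}=\operatorname{argmin}_{x\in\mathcal X}\{\mathcal L(x,y_{k+1},\bar\lambda_{k+1})+\frac{\eta_{f,k}}{2\alpha_k^2}\|x-\widetilde x_k\|^2\},\\ \lambda_{k+1}=\lambda_k+\frac{\alpha_k}{\theta_k}(Av_{k+1}+Bw_{k+1}-b),\\ y_{k+1}=\operatorname{argmin}_{y\in\mathcal Y}\{\mathcal L(x_{k+1},y,\bar\lambda_{k+1})+\frac{\eta_{g,k}}{2\alpha_k^2}\|y-\widetilde y_k\|^2\},\\ w_{k+1}=y_{k+1}+(y_{k+1}-y_k)/\alpha_k.\end{cases}$$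 Discrete Lyapunov function: $\mathcal E_k=\mathcal L(x_k,y_k,\lambda^* )-\mathcal L(x^*,y^*,\lambda_k)+\frac{\gamma_k}2\|v_k-x^*\|^2+\frac{\beta_k}2\|w_k-y^*\|^2+\frac{\theta_k}2\|\lambda_k-\lambda^*\|^2$. Convention: a term with $\mu_f$ (resp. $\mu_g$) in the denominator is $+\infty$ when $\mu_f=0$ (resp. $\mu_g=0$).
   Formalization: When μ_f>0 (resp. μ_g>0) the sum rule ∂(f+δ_X)(x) ⊂ ∂f(x)+N_X(x) on X (resp. for g on Y) is assumed; without it the claim fails, e.g. f(u,v)=−√u on u≥0 with X={u=0}, where f is in S^0_μ(X) vacuously. *)

(* Defs.v *)
From mathcomp Require Export all_boot all_order all_algebra.
From mathcomp Require Export all_classical all_reals all_analysis.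

Set Implicit Arguments.
Unset Strict Implicit.
Unset Printing Implicit Defensive.

Import Order.TTheory GRing.Theory Num.Theory.
Import numFieldNormedType.Exports.

Local Open Scope classical_set_scope.
Local Open Scope ring_scope.

(* The library norm on 'cV[R]_n is the sup norm, hence the Euclidean notions
   below. The library topology on 'cV[R]_n is the usual one. *)
Definition dot (R : realType) (n : nat) (u v : 'cV[R]_n) : R :=
  \sum_(i < n) u i 0 * v i 0.

Definition enorm (R : realType) (n : nat) (u : 'cV[R]_n) : R :=
  Num.sqrt (dot u u).

Definition opnorm (R : realType) (p q : nat) (M : 'M[R]_(p, q)) : R :=
  sup [set enorm (M *m u) | u in [set u : 'cV[R]_q | enorm u <= 1]].

Definition proper_efun (R : realType) (n : nat) (f : 'cV[R]_n -> \bar R) : Prop :=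
  (forall x, f x != -oo%E) /\ (exists x, (f x < +oo)%E).

Definition convex_efun (R : realType) (n : nat) (f : 'cV[R]_n -> \bar R) : Prop :=
  forall (x z : 'cV[R]_n) (t : R), 0 <= t <= 1 ->
    (f (t *: x + (1 - t) *: z)%R <= t%:E * f x + (1 - t)%:E * f z)%E.

(* A closed function is one with closed epigraph, i.e. a lower semicontinuous
   one. *)
Definition proper_closed_convex (R : realType) (n : nat)
    (f : 'cV[R]_n -> \bar R) : Prop :=
  [/\ proper_efun f, lower_semicontinuous f & convex_efun f].

Definition subdiff (R : realType) (n : nat) (f : 'cV[R]_n -> \bar R)
    (x : 'cV[R]_n) : set 'cV[R]_n :=
  [set p | forall z, (f x + (dot p (z - x))%:E <= f z)%E].

Definition normal_cone (R : realType) (n : nat) (X : set 'cV[R]_n)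
    (x : 'cV[R]_n) : set 'cV[R]_n :=
  [set q | forall z, X z -> dot q (z - x) <= 0].

Definition delta_ind (R : realType) (T : Type) (D : set T) (x : T) : \bar R :=
  if `[< D x >] then 0%E else +oo%E.

(* The class S^0_mu(X). For proper f, a subgradient at x2 exists only when
   f x2 is finite, so the differences below are never of the form oo - oo. *)
Definition S0 (R : realType) (n : nat) (mu : R) (X : set 'cV[R]_n)
    (f : 'cV[R]_n -> \bar R) : Prop :=
  forall x1 x2 p, X x1 -> X x2 -> subdiff f x2 p ->
    ((mu / 2 * enorm (x1 - x2) ^+ 2)%:E
       <= f x1 - f x2 - (dot p (x1 - x2))%:E)%E.

(* The nontrivial inclusion of the subdifferential sum rule
   d(f + delta_X)(x) = df(x) + N_X(x), x in X; it holds for instance when the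
   relative interiors of X and dom f meet. S0 only constrains f at points of X
   where df is nonempty, and without the sum rule there may be none: for
   f(u,v) = - sqrt u on u >= 0 and X = {u = 0}, S0 mu X f holds vacuously for
   every mu although f is constant on X. *)
Definition subdiff_sum_rule (R : realType) (n : nat) (X : set 'cV[R]_n)
    (f : 'cV[R]_n -> \bar R) : Prop :=
  forall x, X x ->
    subdiff (fun z => f z + delta_ind R X z)%E x
      `<=` [set p + q | p in subdiff f x & q in normal_cone X x].

(* As usual for extended-valued functions, the argmin of a function that is
   identically +oo on D is empty. *)
Definition argmin (R : realType) (T : Type) (D : set T) (phi : T -> \bar R) :
    set T :=
  [set x | [/\ D x, (phi x < +oo)%E & forall z, D z -> (phi x <= phi z)%E]].

(* prox^X_{s f}(z), as the set of minimizers. *)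
Definition prox (R : realType) (n : nat) (X : set 'cV[R]_n)
    (s : R) (f : 'cV[R]_n -> \bar R) (z : 'cV[R]_n) : set 'cV[R]_n :=
  argmin X (fun x => f x + (1 / (2 * s) * enorm (x - z) ^+ 2)%:E)%E.

Record problem (R : realType) (m n r : nat) := Problem {
  setX : set 'cV[R]_m;
  setY : set 'cV[R]_n;
  objf : 'cV[R]_m -> \bar R;
  objg : 'cV[R]_n -> \bar R;
  matA : 'M[R]_(r, m);
  matB : 'M[R]_(r, n);
  rhs : 'cV[R]_r }.

Definition standing (R : realType) (m n r : nat) (P : problem R m n r) : Prop :=
  [/\ closed (setX P) /\ convex_set (setX P : set (convex_lmodType 'cV[R]_m)),
      closed (setY P) /\ convex_set (setY P : set (convex_lmodType 'cV[R]_n)),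
      proper_closed_convex (objf P) & proper_closed_convex (objg P)].

Definition objF (R : realType) (m n r : nat) (P : problem R m n r)
    (x : 'cV[R]_m) (y : 'cV[R]_n) : \bar R :=
  (objf P x + objg P y)%E.

Definition residual (R : realType) (m n r : nat) (P : problem R m n r)
    (x : 'cV[R]_m) (y : 'cV[R]_n) : 'cV[R]_r :=
  matA P *m x + matB P *m y - rhs P.

Definition lagrangian (R : realType) (m n r : nat) (P : problem R m n r)
    (x : 'cV[R]_m) (y : 'cV[R]_n) (l : 'cV[R]_r) : \bar R :=
  (objF P x y + delta_ind R (setX P `*` setY P) (x, y)
     + (dot l (residual P x y))%:E)%E.

Definition saddle_point (R : realType) (m n r : nat) (P : problem R m n r)
    (xs : 'cV[R]_m) (ys : 'cV[R]_n) (ls : 'cV[R]_r) : Prop :=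
  [/\ setX P xs, setY P ys &
      forall x y l,
        (lagrangian P xs ys l <= lagrangian P xs ys ls)%E /\
        (lagrangian P xs ys ls <= lagrangian P x y ls)%E].

Record params (R : realType) := Params {
  alpha : nat -> R;
  theta : nat -> R;
  gamma : nat -> R;
  beta : nat -> R }.

Definition params_ok (R : realType) (mu_f mu_g : R) (c : params R) : Prop :=
  [/\ theta c 0 = 1, 0 < gamma c 0, 0 < beta c 0, (forall k, 0 < alpha c k) &
      forall k,
      [/\ (theta c k.+1 - theta c k) / alpha c k = - theta c k.+1,
          (gamma c k.+1 - gamma c k) / alpha c k = mu_f - gamma c k.+1 &
          (beta c k.+1 - beta c k) / alpha c k = mu_g - beta c k.+1]].

Definition eta_f (R : realType) (mu_f : R) (c : params R) (k : nat) : R :=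
  (alpha c k + 1) * gamma c k + mu_f * alpha c k.

Definition eta_g (R : realType) (mu_g : R) (c : params R) (k : nat) : R :=
  (alpha c k + 1) * beta c k + mu_g * alpha c k.

Record iterates (R : realType) (m n r : nat) := Iterates {
  itx : nat -> 'cV[R]_m;
  itv : nat -> 'cV[R]_m;
  ity : nat -> 'cV[R]_n;
  itw : nat -> 'cV[R]_n;
  itl : nat -> 'cV[R]_r }.

Definition xtilde (R : realType) (m n r : nat) (mu_f : R) (c : params R)
    (it : iterates R m n r) (k : nat) : 'cV[R]_m :=
  itx it k + (alpha c k * gamma c k / eta_f mu_f c k) *: (itv it k - itx it k).

Definition ytilde (R : realType) (m n r : nat) (mu_g : R) (c : params R)
    (it : iterates R m n r) (k : nat) : 'cV[R]_n :=
  ity it k + (alpha c k * beta c k / eta_g mu_g c k) *: (itw it k - ity it k).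

(* Scheme (G); lbar k.+1 is the multiplier used at step k, and lbar 0 plays no
   role. *)
Definition schemeG (R : realType) (m n r : nat) (P : problem R m n r)
    (mu_f mu_g : R) (c : params R) (lbar : nat -> 'cV[R]_r)
    (it : iterates R m n r) : Prop :=
  forall k : nat,
  [/\ itv it k.+1 = itx it k.+1 + (alpha c k)^-1 *: (itx it k.+1 - itx it k),
      argmin (setX P) (fun x =>
        lagrangian P x (ity it k.+1) (lbar k.+1)
        + (eta_f mu_f c k / (2 * alpha c k ^+ 2)
             * enorm (x - xtilde mu_f c it k) ^+ 2)%:E)%E (itx it k.+1),
      itl it k.+1 = itl it k
        + (alpha c k / theta c k) *: residual P (itv it k.+1) (itw it k.+1),
      argmin (setY P) (fun y =>
        lagrangian P (itx it k.+1) y (lbar k.+1)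
        + (eta_g mu_g c k / (2 * alpha c k ^+ 2)
             * enorm (y - ytilde mu_g c it k) ^+ 2)%:E)%E (ity it k.+1) &
      itw it k.+1 = ity it k.+1 + (alpha c k)^-1 *: (ity it k.+1 - ity it k)].

Definition lbar_explicit (R : realType) (m n r : nat) (P : problem R m n r)
    (c : params R) (it : iterates R m n r) (lbar : nat -> 'cV[R]_r) : Prop :=
  forall k : nat,
    lbar k.+1 = itl it k
      + (alpha c k / theta c k) *: residual P (itv it k) (itw it k).

Definition prox_algorithm (R : realType) (m n r : nat) (P : problem R m n r)
    (mu_f mu_g : R) (c : params R) (lbar : nat -> 'cV[R]_r)
    (it : iterates R m n r) : Prop :=
  lbar_explicit P c it lbar /\
  forall k : nat,
  let s := alpha c k ^+ 2 / eta_f mu_f c k in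
  let tau := alpha c k ^+ 2 / eta_g mu_g c k in
  [/\ prox (setX P) s (objf P)
        (xtilde mu_f c it k - s *: ((matA P)^T *m lbar k.+1)) (itx it k.+1),
      itv it k.+1 = itx it k.+1 + (alpha c k)^-1 *: (itx it k.+1 - itx it k),
      prox (setY P) tau (objg P)
        (ytilde mu_g c it k - tau *: ((matB P)^T *m lbar k.+1)) (ity it k.+1),
      itw it k.+1 = ity it k.+1 + (alpha c k)^-1 *: (ity it k.+1 - ity it k) &
      itl it k.+1 = itl it k
        + (alpha c k / theta c k) *: residual P (itv it k.+1) (itw it k.+1)].

Definition gap (R : realType) (m n r : nat) (P : problem R m n r)
    (it : iterates R m n r)
    (xs : 'cV[R]_m) (ys : 'cV[R]_n) (ls : 'cV[R]_r) (k : nat) : \bar R :=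
  (lagrangian P (itx it k) (ity it k) ls - lagrangian P xs ys (itl it k))%E.

(* +oo is possible at k = 0, since (x_0, y_0) is an arbitrary initial guess. *)
Definition lyapunov (R : realType) (m n r : nat) (P : problem R m n r)
    (c : params R) (it : iterates R m n r)
    (xs : 'cV[R]_m) (ys : 'cV[R]_n) (ls : 'cV[R]_r) (k : nat) : \bar R :=
  (gap P it xs ys ls k
    + (gamma c k / 2 * enorm (itv it k - xs) ^+ 2)%:E
    + (beta c k / 2 * enorm (itw it k - ys) ^+ 2)%:E
    + (theta c k / 2 * enorm (itl it k - ls) ^+ 2)%:E)%E.

Definition calR0 (R : realType) (m n r : nat) (P : problem R m n r)
    (c : params R) (it : iterates R m n r)
    (xs : 'cV[R]_m) (ys : 'cV[R]_n) (ls : 'cV[R]_r) : \bar R :=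
  (sqrte (2%:E * lyapunov P c it xs ys ls 0)
    + (enorm (itl it 0 - ls))%:E
    + (enorm (residual P (itx it 0) (ity it 0)))%:E)%E.

(* min { a / (sqrt g0 * k), a ^ 2 / (mu * k ^ 2) }, the second term being +oo
   when mu = 0. *)
Definition rate_term (R : realType) (a g0 mu : R) (k : nat) : \bar R :=
  mine (a / (Num.sqrt g0 * k%:R))%:E
       (if mu == 0 then +oo%E else (a ^+ 2 / (mu * k%:R ^+ 2))%:E).

(* Main.v *)
(* The proximal step is an argmin of the step of (G) after completing the square.
   Its optimality condition (strengthened by mu/2 |.|^2 through the subdifferential
   sum rule when mu > 0), tested at x_k and at x^* with weights 1 and alpha_k,
   bounds the primal part of (1 + alpha_k) E_{k+1} - E_k. Adding the dual part
   leaves alpha_k^2 / (2 theta_k) |A (v_{k+1} - v_k) + B (w_{k+1} - w_k)|^2,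
   which the step size rule absorbs in the terms gamma_k/2 |v_{k+1} - v_k|^2 and
   beta_k/2 |w_{k+1} - w_k|^2. Hence E_k <= theta_k E_0; the residual bound
   follows since (A x_k + B y_k - b) / theta_k - lambda_k does not depend on k.

   For the rate, put phi_k = 1 / theta_k, a = |A| / sqrt gamma_0 and
   b = |B| / sqrt beta_0. The step size rule gives a constant lower bound on the
   increments of a psi_f(phi_k) + b psi_g(phi_k), where psi(phi) is phi when
   mu = 0 and a multiple of sqrt phi when mu > 0, so one of the two summands is
   at least of order k. *)
Require Import Defs.
From mathcomp Require Import ring lra.

Set Implicit Arguments.
Unset Strict Implicit.
Unset Printing Implicit Defensive.

Import Order.TTheory GRing.Theory Num.Theory.
Import numFieldNormedType.Exports.
Local Open Scope classical_set_scope.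
Local Open Scope ring_scope.

(** * Euclidean and operator norms *)

Lemma dotC (R : realType) (n : nat) (u v : 'cV[R]_n) : dot u v = dot v u.
Proof. by apply: eq_bigr => i _; rewrite mulrC. Qed.

Lemma dotDl (R : realType) (n : nat) (u v w : 'cV[R]_n) :
  dot (u + v) w = dot u w + dot v w.
Proof. by rewrite -big_split; apply: eq_bigr => i _; rewrite !mxE mulrDl. Qed.

Lemma dotZl (R : realType) (n : nat) (a : R) (u v : 'cV[R]_n) :
  dot (a *: u) v = a * dot u v.
Proof. by rewrite mulr_sumr; apply: eq_bigr => i _; rewrite !mxE mulrA. Qed.

Lemma dotDr (R : realType) (n : nat) (u v w : 'cV[R]_n) :
  dot u (v + w) = dot u v + dot u w.
Proof. by rewrite dotC dotDl !(dotC u). Qed.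

Lemma dotZr (R : realType) (n : nat) (a : R) (u v : 'cV[R]_n) :
  dot u (a *: v) = a * dot u v.
Proof. by rewrite dotC dotZl dotC. Qed.

Lemma dotNl (R : realType) (n : nat) (u v : 'cV[R]_n) : dot (- u) v = - dot u v.
Proof. by rewrite -scaleN1r dotZl mulN1r. Qed.

Lemma dotNr (R : realType) (n : nat) (u v : 'cV[R]_n) : dot u (- v) = - dot u v.
Proof. by rewrite -scaleN1r dotZr mulN1r. Qed.

Lemma dot0r (R : realType) (n : nat) (u : 'cV[R]_n) : dot u 0 = 0.
Proof. by rewrite -(scale0r u) dotZr mul0r. Qed.

Lemma dot_ge0 (R : realType) (n : nat) (u : 'cV[R]_n) : 0 <= dot u u.
Proof. by apply: sumr_ge0 => i _; rewrite -expr2 sqr_ge0. Qed.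

Lemma dot_trmx (R : realType) (p q : nat) (M : 'M[R]_(p, q)) u v :
  dot (M^T *m u) v = dot u (M *m v).
Proof.
have dotE n (a b : 'cV[R]_n) : dot a b = (a^T *m b) 0 0.
  by rewrite mxE; apply: eq_bigr => i _; rewrite !mxE.
by rewrite !dotE trmx_mul trmxK mulmxA.
Qed.

Lemma enorm_ge0 (R : realType) (n : nat) (u : 'cV[R]_n) : 0 <= enorm u.
Proof. exact: sqrtr_ge0. Qed.

Lemma sqr_enorm (R : realType) (n : nat) (u : 'cV[R]_n) : enorm u ^+ 2 = dot u u.
Proof. by rewrite sqr_sqrtr ?dot_ge0. Qed.

Lemma enormZ (R : realType) (n : nat) (a : R) (u : 'cV[R]_n) :
  enorm (a *: u) = `|a| * enorm u.
Proof.
by rewrite /enorm dotZl dotZr mulrA -expr2 sqrtrM ?sqr_ge0 // sqrtr_sqr.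
Qed.

Lemma enormN (R : realType) (n : nat) (u : 'cV[R]_n) : enorm (- u) = enorm u.
Proof. by rewrite -scaleN1r enormZ normrN1 mul1r. Qed.

Lemma enorm_eq0 (R : realType) (n : nat) (u : 'cV[R]_n) : enorm u = 0 -> u = 0.
Proof.
move=> u0; have : dot u u = 0 by rewrite -sqr_enorm u0 expr0n.
move/eqP; rewrite psumr_eq0; last by move=> i _; rewrite -expr2 sqr_ge0.
move=> /allP uu0; apply/colP => i; rewrite mxE; apply/eqP.
by move: (uu0 i (mem_index_enum i)); rewrite /= mulf_eq0 orbb.
Qed.

(** Cauchy-Schwarz: expand the nonnegative square of [enorm v *: u - enorm u *: v] and divide by
    [enorm u * enorm v]. *)
Lemma dot_le_enorm (R : realType) (n : nat) (u v : 'cV[R]_n) :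
  dot u v <= enorm u * enorm v.
Proof.
have [->|v0] := eqVneq v 0.
  by rewrite dot0r mulr_ge0 ?enorm_ge0.
have nv : 0 < enorm v.
  by rewrite lt_def enorm_ge0 andbT; apply: contra_neq v0; exact: enorm_eq0.
have := dot_ge0 (enorm v *: u - enorm u *: v).
have [->|u0] := eqVneq u 0; first by rewrite dotC dot0r mulr_ge0 ?enorm_ge0.
have nu : 0 < enorm u.
  by rewrite lt_def enorm_ge0 andbT; apply: contra_neq u0; exact: enorm_eq0.
rewrite !(dotDl, dotDr, dotNl, dotNr, dotZl, dotZr) -!sqr_enorm (dotC v u) => h.
rewrite -(ler_pM2l (mulr_gt0 nu nv)); nra.
Qed.

Lemma norm_dot_le (R : realType) (n : nat) (u v : 'cV[R]_n) :
  `|dot u v| <= enorm u * enorm v.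
Proof.
rewrite ler_norml dot_le_enorm andbT lerNl -dotNl -(enormN u).
exact: dot_le_enorm.
Qed.

Lemma enormD (R : realType) (n : nat) (u v : 'cV[R]_n) :
  enorm (u + v) <= enorm u + enorm v.
Proof.
rewrite -(@ler_pXn2r _ 2) ?nnegrE ?addr_ge0 ?enorm_ge0 //.
rewrite sqr_enorm dotDl !dotDr sqrrD -!sqr_enorm (dotC v u).
have := dot_le_enorm u v; lra.
Qed.

(** The Frobenius norm is an upper bound, by Cauchy-Schwarz on each row; this makes the [sup] in
    [opnorm] a genuine supremum. *)
Lemma has_ubound_opnorm (R : realType) (p q : nat) (M : 'M[R]_(p, q)) :
  has_ubound [set enorm (M *m u) | u in [set u : 'cV[R]_q | enorm u <= 1]].
Proof.
exists (Num.sqrt (\sum_(i < p) enorm (row i M)^T ^+ 2)) => _ [u /= u1 <-].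
apply: ler_wsqrtr; apply: ler_sum => i _; rewrite -expr2.
have -> : (M *m u) i 0 = dot (row i M)^T u.
  by rewrite mxE; apply: eq_bigr => j _; rewrite !mxE.
rewrite -[leLHS]real_normK ?num_real// ler_pXn2r ?nnegrE ?enorm_ge0//.
apply: le_trans (norm_dot_le _ _) _.
by rewrite -[leRHS]mulr1 ler_wpM2l ?enorm_ge0.
Qed.

Lemma opnorm_ge0 (R : realType) (p q : nat) (M : 'M[R]_(p, q)) : 0 <= opnorm M.
Proof.
apply: ub_le_sup; first exact: has_ubound_opnorm.
by exists 0; rewrite /= ?mulmx0 /enorm dot0r sqrtr0.
Qed.

Lemma enorm_mulmx (R : realType) (p q : nat) (M : 'M[R]_(p, q)) (u : 'cV[R]_q) :
  enorm (M *m u) <= opnorm M * enorm u.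
Proof.
have [->|u0] := eqVneq u 0.
  by rewrite mulmx0 {1}/enorm dot0r sqrtr0 mulr_ge0 ?opnorm_ge0 ?enorm_ge0.
have nu : 0 < enorm u.
  by rewrite lt_def enorm_ge0 andbT; apply: contra_neq u0; exact: enorm_eq0.
rewrite -ler_pdivrMr//; apply: ub_le_sup; first exact: has_ubound_opnorm.
exists ((enorm u)^-1 *: u) => /=.
  by rewrite enormZ ger0_norm ?invr_ge0 ?enorm_ge0// mulVf// gt_eqF.
rewrite -scalemxAr enormZ ger0_norm ?invr_ge0 ?enorm_ge0// mulrC //.
Qed.

(** * Proximal points *)

Lemma convex_set_comb (R : realType) (n : nat) (X : set 'cV[R]_n) x z t :
  convex_set (X : set (convex_lmodType 'cV[R]_n)) -> X x -> X z ->
  0 <= t <= 1 -> X (t *: x + (1 - t) *: z).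
Proof.
move=> cX Xx Xz /andP[t0 t1].
have := cX x z (Itv01 t0 t1).
by rewrite !inE; apply.
Qed.

Lemma argmin_fin_num (R : realType) (T : Type) (D : set T) (f : T -> \bar R)
    (q : T -> R) x :
  (forall z, f z != -oo%E) -> argmin D (fun z => f z + (q z)%:E)%E x ->
  D x /\ f x \is a fin_num.
Proof.
move=> fN [Dx fx _]; split=> //.
rewrite fin_numE fN /=; apply: contraTneq fx => ->.
by rewrite addye.
Qed.

(** First-order condition without limits: if [a < 0], the linear term wins at an explicit small
    [t]. *)
Lemma ge0_of_small_quadratic (R : realFieldType) (a b : R) :
  (forall t, 0 < t <= 1 -> 0 <= t * a + t ^+ 2 * b) -> 0 <= a.
Proof.
move=> h; rewrite leNgt; apply/negP => a0.
have d0 : 0 < 1 + `|b| - a by have := normr_ge0 b; lra.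
(* With this [t], [t * |b| = - a - t * (1 - a) < - a], so [a + t * b < 0]. *)
pose t := - a / (1 + `|b| - a).
have t0 : 0 < t by rewrite divr_gt0 // oppr_gt0.
have t1 : t <= 1 by rewrite ler_pdivrMr// mul1r; have := normr_ge0 b; lra.
have := h t; rewrite t0 t1 => /(_ isT).
rewrite expr2 -mulrA -mulrDr pmulr_rge0// => ht.
have : t * b <= t * `|b| by rewrite ler_pM2l // ler_norm.
have : t * (1 + `|b| - a) = - a by rewrite /t divfK ?gt_eqF.
nra.
Qed.

(* The right-hand multiplier is [- s^-1 (x - c)], the subgradient of
   [f + delta_X] at the proximal point [x]. *)
Lemma prox_subgradient (R : realType) (n : nat) (X : set 'cV[R]_n)
    (f : 'cV[R]_n -> \bar R) (s : R) c x :
  convex_set (X : set (convex_lmodType 'cV[R]_n)) -> proper_efun f ->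
  convex_efun f -> 0 < s -> prox X s f c x ->
  forall z, X z -> f z \is a fin_num ->
    fine (f x) + dot (- s^-1 *: (x - c)) (z - x) <= fine (f z).
Proof.
move=> cX [fN _] cf s0 px z Xz fz.
have [Xx fx] := argmin_fin_num fN px; case: px => _ _ minx.
rewrite -subr_ge0.
(* Minimality of [x] is tested at the points [t *: z + (1 - t) *: x] of the segment towards [z].
   Convexity bounds [f] there, and the quadratic penalty contributes the coefficient of [t ^+ 2]. *)
apply: (@ge0_of_small_quadratic _ _ (1 / (2 * s) * dot (z - x) (z - x))).
move=> t /andP[t0 t1].
have t01 : 0 <= t <= 1 by rewrite ltW.
have Xt := convex_set_comb cX Xz Xx t01.
have := le_trans (minx _ Xt) (leeD2r _ (cf _ _ _ t01)).
rewrite -(fineK fx) -(fineK fz) -!EFinM -!EFinD lee_fin.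
set u := t *: z + _ - c.
have -> : u = (x - c) + t *: (z - x).
  by apply/colP => i; rewrite !mxE; ring.
move: (x - c) (z - x) => w d.
rewrite !sqr_enorm !(dotDl, dotDr, dotZl, dotZr) (dotC d w) -subr_ge0 => h.
apply: le_trans h _; rewrite le_eqVlt; apply/orP; left; apply/eqP.
by field; rewrite gt_eqF.
Qed.

(** For [mu > 0] the sum rule splits the proximal multiplier into [p + q] with [p] in the
    subdifferential of [f] and [q] normal to [X]. [S0] supplies the quadratic gain for [p], and the
    term in [q] is nonpositive. *)
Lemma prox_strong_subgradient (R : realType) (n : nat) (X : set 'cV[R]_n)
    (f : 'cV[R]_n -> \bar R) (mu s : R) c x :
  convex_set (X : set (convex_lmodType 'cV[R]_n)) -> proper_efun f ->
  convex_efun f -> 0 <= mu -> S0 mu X f ->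
  (0 < mu -> subdiff_sum_rule X f) -> 0 < s -> prox X s f c x ->
  forall z, X z -> f z \is a fin_num ->
    fine (f x) + dot (- s^-1 *: (x - c)) (z - x) + mu / 2 * dot (z - x) (z - x)
      <= fine (f z).
Proof.
move=> cX pf cf mu0 Sf sumf s0 px z Xz fz.
have sg := prox_subgradient cX pf cf s0 px.
have [Xx fx] := argmin_fin_num pf.1 px.
case: (ltrgtP 0 mu) mu0 => // [mup|<-] _; last first.
  by rewrite !mul0r addr0; exact: sg.
have : subdiff (fun z => f z + delta_ind R X z)%E x (- s^-1 *: (x - c)).
  move=> y /=; rewrite /delta_ind asboolT// adde0.
  have [Xy|nXy] := asboolP (X y); last by rewrite addey ?leey ?pf.1.
  rewrite adde0.
  have [fy|] := boolP (f y \is a fin_num).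
    by rewrite -(fineK fx) -(fineK fy) -EFinD lee_fin; exact: sg.
  by rewrite fin_numEn (negbTE (pf.1 y)) /= => /eqP ->; rewrite leey.
move/(sumf mup x Xx) => [p pp [q qq <-]].
have := Sf z x p Xz Xx pp.
rewrite sqr_enorm -(fineK fx) -(fineK fz).
rewrite -!EFinB lee_fin /=.
by have := qq z Xz; rewrite (dotDl p q); lra.
Qed.

(** * One step of the algorithm *)

(** Rewrites the proximal multiplier through increments of [v], which eliminates the extrapolated
    centre and [eta]. *)
Lemma prox_multiplier (R : realType) (n : nat) (mu a g : R)
    (x x' v v' q : 'cV[R]_n) :
  0 < a -> 0 < g -> 0 <= mu -> v' = x' + a^-1 *: (x' - x) ->
  let eta := (a + 1) * g + mu * a in
  let s := a ^+ 2 / eta in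
  - s^-1 *: (x' - (x + (a * g / eta) *: (v - x) - s *: q))
    = - q - a^-1 *: (g *: (v' - v) + (mu * a) *: (v' - x')).
Proof.
move=> a0 g0 mu0 -> eta s; rewrite /s.
have eta0 : eta != 0.
  by rewrite gt_eqF// /eta ltr_pwDl ?mulr_gt0 ?mulr_ge0 ?addr_gt0 // ltW.
apply/colP => i; rewrite !mxE /eta; field.
by rewrite gt_eqF.
Qed.

(** Since [x - x' = - a *: (v' - x')], adding the two inequalities with weights [1] and [a] tests
    [p] against [a *: (xs - v')]. Polarization then produces the squares around [xs]. *)
Lemma block_descent (R : realType) (n : nat) (mu a g fx fx' fs : R)
    (x x' v v' xs q : 'cV[R]_n) :
  0 < a -> 0 < g -> 0 <= mu -> v' = x' + a^-1 *: (x' - x) ->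
  let p := - q - a^-1 *: (g *: (v' - v) + (mu * a) *: (v' - x')) in
  fx' + dot p (x - x') + mu / 2 * dot (x - x') (x - x') <= fx ->
  fx' + dot p (xs - x') + mu / 2 * dot (xs - x') (xs - x') <= fs ->
  (1 + a) * fx' + (g + a * mu) / 2 * dot (v' - xs) (v' - xs)
    + a * dot q (v' - xs) + g / 2 * dot (v' - v) (v' - v)
  <= fx + a * fs + g / 2 * dot (v - xs) (v - xs).
Proof.
move=> a0 g0 mu0 hv p hx hs.
have id_ : dot p (x - x') + a * dot p (xs - x')
   + a * mu / 2 * dot (xs - x') (xs - x')
   - (g + a * mu) / 2 * dot (v' - xs) (v' - xs)
   - a * dot q (v' - xs) - g / 2 * dot (v' - v) (v' - v)
   + g / 2 * dot (v - xs) (v - xs) = a * mu / 2 * dot (v' - x') (v' - x').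
  rewrite /dot !mulr_sumr -!sumrN -!big_split /=; apply: eq_bigr => i _.
  by rewrite /p hv !mxE; field; rewrite gt_eqF.
have := ler_wpM2l (ltW a0) hs.
have : 0 <= mu / 2 * dot (x - x') (x - x').
  by rewrite mulr_ge0 ?dot_ge0 ?divr_ge0.
have : 0 <= a * mu / 2 * dot (v' - x') (v' - x').
  by rewrite mulr_ge0 ?dot_ge0 ?divr_ge0 ?mulr_ge0 // ltW.
lra.
Qed.

(** * Recurrences and positivity of the parameters *)

Section StepParameters.
Variables (R : realType) (mu_f mu_g : R) (c : params R).
Hypotheses (f0 : 0 <= mu_f) (g0 : 0 <= mu_g) (c_ok : params_ok mu_f mu_g c).

Lemma implicit_euler (a u u' m : R) :
  0 < a -> (u' - u) / a = m - u' -> (1 + a) * u' = u + a * m.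
Proof.
move=> a0 /(congr1 ( *%R^~ a)); rewrite divfK ?gt_eqF// => h; lra.
Qed.

Lemma alpha_gt0 k : 0 < alpha c k.
Proof. by case: c_ok. Qed.

Lemma thetaS k : (1 + alpha c k) * theta c k.+1 = theta c k.
Proof.
case: c_ok => _ _ _ _ /(_ k)[h _ _].
rewrite -[- theta c k.+1]sub0r in h.
by rewrite (implicit_euler (alpha_gt0 k) h) mulr0 addr0.
Qed.

Lemma gammaS k : (1 + alpha c k) * gamma c k.+1 = gamma c k + alpha c k * mu_f.
Proof.
by case: c_ok => _ _ _ _ /(_ k)[_ h _]; exact: implicit_euler (alpha_gt0 k) h.
Qed.

Lemma betaS k : (1 + alpha c k) * beta c k.+1 = beta c k + alpha c k * mu_g.
Proof.
by case: c_ok => _ _ _ _ /(_ k)[_ _ h]; exact: implicit_euler (alpha_gt0 k) h.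
Qed.

Lemma theta_gt0 k : 0 < theta c k.
Proof.
elim: k => [|k IH]; first by case: c_ok => ->.
have a1 : 0 < 1 + alpha c k by rewrite addr_gt0 ?alpha_gt0.
by rewrite -(pmulr_rgt0 _ a1) thetaS.
Qed.

Lemma gamma_gt0 k : 0 < gamma c k.
Proof.
elim: k => [|k IH]; first by case: c_ok.
have a1 : 0 < 1 + alpha c k by rewrite addr_gt0 ?alpha_gt0.
by rewrite -(pmulr_rgt0 _ a1) gammaS ltr_pwDl // mulr_ge0 // ltW ?alpha_gt0.
Qed.

Lemma beta_gt0 k : 0 < beta c k.
Proof.
elim: k => [|k IH]; first by case: c_ok.
have a1 : 0 < 1 + alpha c k by rewrite addr_gt0 ?alpha_gt0.
by rewrite -(pmulr_rgt0 _ a1) betaS ltr_pwDl // mulr_ge0 // ltW ?alpha_gt0.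
Qed.

Lemma eta_f_gt0 k : 0 < eta_f mu_f c k.
Proof.
have a0 := alpha_gt0 k.
by rewrite ltr_pwDl ?mulr_gt0 ?mulr_ge0 ?addr_gt0 ?gamma_gt0 // ltW.
Qed.

Lemma eta_g_gt0 k : 0 < eta_g mu_g c k.
Proof.
have a0 := alpha_gt0 k.
by rewrite ltr_pwDl ?mulr_gt0 ?mulr_ge0 ?addr_gt0 ?beta_gt0 // ltW.
Qed.

End StepParameters.

(* Completing the square: a linear term shifts the centre of the proximal
   quadratic, up to an additive constant. *)
Lemma prox_argmin_linear (R : realType) (n : nat) (X : set 'cV[R]_n)
    (f : 'cV[R]_n -> \bar R) (s d : R) (q c x : 'cV[R]_n) :
  0 < s ->
  prox X s f (c - s *: q) x <->
  argmin X (fun z => f z + (d + dot q z)%:E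
                     + (1 / (2 * s) * enorm (z - c) ^+ 2)%:E)%E x.
Proof.
move=> s0.
pose K := d + dot q c - s / 2 * dot q q.
have E z : (f z + (d + dot q z)%:E + (1 / (2 * s) * enorm (z - c) ^+ 2)%:E =
  f z + (1 / (2 * s) * enorm (z - (c - s *: q)) ^+ 2)%:E + K%:E)%E.
  rewrite -!addeA -!EFinD; congr (_ + _%:E)%E.
  rewrite !sqr_enorm /K !(dotDl, dotDr, dotZl, dotZr, dotNl, dotNr).
  rewrite !(dotC _ q) (dotC c z); field; rewrite gt_eqF //.
rewrite /prox /argmin /=; split=> -[Xx xoo xmin]; split=> //.
- by rewrite E; apply: lte_add_pinfty => //; exact: ltry.
- by move=> z Xz; rewrite !E leeD2rE//; exact: xmin.
- by move: xoo; rewrite E !ltey; apply: contra_neq => ->; rewrite addye.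
- by move=> z Xz; have := xmin z Xz; rewrite !E leeD2rE.
Qed.

(** * The Lagrangian and the two schemes *)

Lemma argmin_ext (R : realType) (T : Type) (D : set T) (f g : T -> \bar R) x :
  (forall z, D z -> f z = g z) -> argmin D f x -> argmin D g x.
Proof.
move=> fg [Dx fx minx]; split=> //; first by rewrite -fg.
by move=> z Dz; rewrite -!fg //; exact: minx.
Qed.

Section Lagrangian.
Variables (R : realType) (m n r : nat) (P : problem R m n r).
Hypotheses (fN : forall x, objf P x != -oo%E) (gN : forall y, objg P y != -oo%E).

(** For [f] and [g] that never take the value [-oo], these are exactly the points where the
    Lagrangian is finite; elsewhere it is [+oo]. *)
Definition feasible x y :=
  [/\ setX P x, setY P y, objf P x \is a fin_num & objg P y \is a fin_num].

Lemma lagrangianE x y l : setX P x -> setY P y ->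
  lagrangian P x y l = (objf P x + objg P y + (dot l (residual P x y))%:E)%E.
Proof. by move=> Xx Yy; rewrite /lagrangian /delta_ind asboolT ?adde0. Qed.

Lemma lagrangian_fin x y l : feasible x y ->
  lagrangian P x y l = (fine (objf P x) + fine (objg P y)
                        + dot l (residual P x y))%:E.
Proof.
by case=> Xx Yy fx gy; rewrite lagrangianE// !EFinD !fineK.
Qed.

Lemma lagrangian_infty x y l : ~ feasible x y -> lagrangian P x y l = +oo%E.
Proof.
move=> nF; suff: (objF P x y + delta_ind R (setX P `*` setY P) (x, y))%E = +oo%E.
  by rewrite /lagrangian => ->; rewrite addye.
have FN : objF P x y != -oo%E by rewrite adde_eq_ninfty negb_or fN gN.
rewrite /delta_ind; case: asboolP => [[/= Xx Yy]|_]; last by rewrite addey.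
have [fx|] := boolP (objf P x \is a fin_num); last first.
  by rewrite fin_numEn (negbTE (fN x)) => /eqP; rewrite /objF => ->; rewrite addye.
have [gy|] := boolP (objg P y \is a fin_num); first by case: nF.
by rewrite fin_numEn (negbTE (gN y)) => /eqP; rewrite /objF => ->; rewrite addey.
Qed.

Lemma saddle_point_feasible xs ys ls x y :
  saddle_point P xs ys ls -> feasible x y -> feasible xs ys.
Proof.
case=> _ _ sp Fxy; apply: contrapT => nF.
by have [_] := sp x y ls; rewrite (lagrangian_infty _ nF) lagrangian_fin.
Qed.

(** Testing the dual inequality at the multiplier [ls + residual P xs ys] gives a nonpositive
    squared norm. *)
Lemma saddle_point_residual xs ys ls :
  saddle_point P xs ys ls -> feasible xs ys -> residual P xs ys = 0.
Proof.
case=> _ _ sp Fs; have [+ _] := sp xs ys (ls + residual P xs ys).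
rewrite !lagrangian_fin// lee_fin dotDl => h.
apply: enorm_eq0; apply/eqP; rewrite -sqrf_eq0 eq_le sqr_ge0 sqr_enorm andbT.
by move: h; lra.
Qed.

Lemma residual_extrapolation (a : R) x x' y y' : a != 0 ->
  a *: residual P (x' + a^-1 *: (x' - x)) (y' + a^-1 *: (y' - y))
    = (1 + a) *: residual P x' y' - residual P x y.
Proof.
move=> a0; rewrite /residual !mulmxDr -!scalemxAr !mulmxBr.
move: (matA P *m x) (matA P *m x') (matB P *m y) (matB P *m y') => u u' w w'.
by apply/colP => i; rewrite !mxE; field.
Qed.

Lemma residualB x x' y y' :
  residual P x' y' - residual P x y = matA P *m (x' - x) + matB P *m (y' - y).
Proof.
rewrite /residual !mulmxBr.
move: (matA P *m x) (matA P *m x') (matB P *m y) (matB P *m y') => u u' w w'.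
by apply/colP => i; rewrite !mxE; ring.
Qed.

(** The factor 2 comes from [(p + q)^2 <= 2 p^2 + 2 q^2] and is the one in the step size rule. *)
Lemma dot_residualB_le x x' y y' :
  dot (residual P x' y' - residual P x y) (residual P x' y' - residual P x y)
    <= 2 * (opnorm (matA P) ^+ 2 * dot (x' - x) (x' - x)
            + opnorm (matB P) ^+ 2 * dot (y' - y) (y' - y)).
Proof.
rewrite residualB -!sqr_enorm -!exprMn.
set u := _ *m _; set w := _ *m _.
have hu : enorm u <= opnorm (matA P) * enorm (x' - x) by exact: enorm_mulmx.
have hw : enorm w <= opnorm (matB P) * enorm (y' - y) by exact: enorm_mulmx.
have huw := enormD u w.
apply: (@le_trans _ _ ((opnorm (matA P) * enorm (x' - x)
                        + opnorm (matB P) * enorm (y' - y)) ^+ 2)).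
  rewrite ler_pXn2r ?nnegrE ?addr_ge0 ?mulr_ge0 ?enorm_ge0 ?opnorm_ge0 //.
  by apply: le_trans huw _; exact: lerD.
set p := _ * enorm _; set q := _ * enorm _.
have := sqr_ge0 (p - q); rewrite sqrrB sqrrD; lra.
Qed.

(** For fixed [y], the Lagrangian on [setX P] is [objf P] plus an affine function of slope
    [(matA P)^T *m l], and [s = a ^+ 2 / e] turns [1 / (2 * s)] into the weight of (G). *)
Lemma prox_objf_argmin (e a : R) (x' c : 'cV[R]_m) y l :
  0 < e -> 0 < a -> setY P y -> objg P y \is a fin_num ->
  prox (setX P) (a ^+ 2 / e) (objf P)
    (c - (a ^+ 2 / e) *: ((matA P)^T *m l)) x' <->
  argmin (setX P) (fun x => lagrangian P x y l
    + (e / (2 * a ^+ 2) * enorm (x - c) ^+ 2)%:E)%E x'.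
Proof.
move=> e0 a0 Yy gy.
have s0 : 0 < a ^+ 2 / e by rewrite divr_gt0 ?exprn_gt0.
rewrite (prox_argmin_linear _ _ (fine (objg P y) + dot l (matB P *m y - rhs P))
  _ _ _ s0).
suff E z : setX P z -> (objf P z + (fine (objg P y)
    + dot l (matB P *m y - rhs P) + dot ((matA P)^T *m l) z)%:E
    + (1 / (2 * (a ^+ 2 / e)) * enorm (z - c) ^+ 2)%:E)%E
  = (lagrangian P z y l + (e / (2 * a ^+ 2) * enorm (z - c) ^+ 2)%:E)%E.
  by split; apply: argmin_ext => z Xz; rewrite E.
move=> Xz; rewrite lagrangianE// -(fineK gy) -!addeA -!EFinD /=.
congr (_ + _%:E)%E; rewrite /residual dot_trmx -(addrA (matA P *m z)).
rewrite (dotDr l (matA P *m z)).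
by field; rewrite !gt_eqF.
Qed.

Lemma prox_objg_argmin (e a : R) x (y' c : 'cV[R]_n) l :
  0 < e -> 0 < a -> setX P x -> objf P x \is a fin_num ->
  prox (setY P) (a ^+ 2 / e) (objg P)
    (c - (a ^+ 2 / e) *: ((matB P)^T *m l)) y' <->
  argmin (setY P) (fun y => lagrangian P x y l
    + (e / (2 * a ^+ 2) * enorm (y - c) ^+ 2)%:E)%E y'.
Proof.
move=> e0 a0 Xx fx.
have s0 : 0 < a ^+ 2 / e by rewrite divr_gt0 ?exprn_gt0.
rewrite (prox_argmin_linear _ _ (fine (objf P x) + dot l (matA P *m x - rhs P))
  _ _ _ s0).
suff E z : setY P z -> (objg P z + (fine (objf P x)
    + dot l (matA P *m x - rhs P) + dot ((matB P)^T *m l) z)%:E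
    + (1 / (2 * (a ^+ 2 / e)) * enorm (z - c) ^+ 2)%:E)%E
  = (lagrangian P x z l + (e / (2 * a ^+ 2) * enorm (z - c) ^+ 2)%:E)%E.
  by split; apply: argmin_ext => z Yz; rewrite E.
move=> Yz; rewrite lagrangianE// (addeC (objf P x)) -(fineK fx) -!addeA -!EFinD /=.
congr (_ + _%:E)%E; rewrite /residual dot_trmx (addrC _ (matB P *m z)).
rewrite -(addrA (matB P *m z)) (dotDr l (matB P *m z)).
by field; rewrite !gt_eqF.
Qed.

Lemma lagrangian_argmin_feasible x y l (q : R) :
  setX P x -> setY P y -> (lagrangian P x y l + q%:E < +oo)%E -> feasible x y.
Proof.
move=> Xx Yy; apply: contraPP => nF.
by rewrite (lagrangian_infty _ nF) addye.
Qed.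

(** * Equivalence of scheme (G) with the proximal algorithm *)

Section Equivalence.
Variables (mu_f mu_g : R) (c : params R) (lbar : nat -> 'cV[R]_r).
Variable it : iterates R m n r.
Hypotheses (f0 : 0 <= mu_f) (g0 : 0 <= mu_g) (c_ok : params_ok mu_f mu_g c).

Lemma prox_algorithm_feasible k : prox_algorithm P mu_f mu_g c lbar it ->
  feasible (itx it k.+1) (ity it k.+1).
Proof.
case=> _ /(_ k) [px _ py _ _].
by have [? ?] := argmin_fin_num fN px; have [? ?] := argmin_fin_num gN py; split.
Qed.

(** Each block of (G) contains the new iterate of the other block, whose objective value must be
    finite before it can be removed as a constant. In both directions this follows from the strict
    bound by [+oo] in [argmin]. *)
Lemma schemeG_prox_algorithm :
  lbar_explicit P c it lbar /\ schemeG P mu_f mu_g c lbar it <->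
  prox_algorithm P mu_f mu_g c lbar it.
Proof.
split=> [[hl hG]|hp].
- split=> // k; have [hv hx hlam hy hw] := hG k.
  have [Xx xoo _] := hx; have [Yy _ _] := hy.
  have [_ _ fx gy] := lagrangian_argmin_feasible Xx Yy xoo.
  have a0 := alpha_gt0 c_ok k.
  have ef0 := eta_f_gt0 f0 c_ok k; have eg0 := eta_g_gt0 g0 c_ok k.
  by split=> //; [exact/(prox_objf_argmin _ _ _ ef0 a0 Yy gy)
                 |exact/(prox_objg_argmin _ _ _ eg0 a0 Xx fx)].
- split=> [|k]; first by case: hp.
  have [Xx Yy fx gy] := prox_algorithm_feasible k hp.
  case: hp => _ /(_ k) [px hv py hw hlam].
  have a0 := alpha_gt0 c_ok k.
  have ef0 := eta_f_gt0 f0 c_ok k; have eg0 := eta_g_gt0 g0 c_ok k.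
  by split=> //; [exact/(prox_objf_argmin _ _ _ ef0 a0 Yy gy)
                 |exact/(prox_objg_argmin _ _ _ eg0 a0 Xx fx)].
Qed.

End Equivalence.
End Lagrangian.

(** The predicted multiplier uses [p], the actual one [p']. The terms linear in [l - ls] cancel, and
    polarizing the product of [p] and [p'] leaves the prediction error [p' - p] as the only
    unfavourable term. *)
Lemma dual_ascent (R : realType) (r : nat) (a t : R) (l ls p p' : 'cV[R]_r) :
  t != 0 ->
  let l' := l + (a / t) *: p' in
  let lbar := l + (a / t) *: p in
  t / 2 * dot (l' - ls) (l' - ls) + a * dot ls p' - a * dot lbar p'
    = t / 2 * dot (l - ls) (l - ls)
      + a ^+ 2 / (2 * t) * (dot (p' - p) (p' - p) - dot p p).
Proof.
move=> t0 l' lbar.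
rewrite /dot -!sumrN !mulr_sumr -!sumrN -!big_split /= mulr_sumr -big_split /=.
by apply: eq_bigr => i _; rewrite /l' /lbar !mxE; field.
Qed.

(** * Decay of the Lyapunov function *)

Section Convergence.
Variables (R : realType) (m n r : nat) (P : problem R m n r).
Variables (mu_f mu_g : R) (c : params R).
Variables (xs : 'cV[R]_m) (ys : 'cV[R]_n) (ls : 'cV[R]_r).
Variables (lbar : nat -> 'cV[R]_r) (it : iterates R m n r).
Hypotheses (std : standing P) (f0 : 0 <= mu_f) (g0 : 0 <= mu_g).
Hypotheses (c_ok : params_ok mu_f mu_g c) (saddle : saddle_point P xs ys ls).
Hypothesis alg : prox_algorithm P mu_f mu_g c lbar it.
Hypotheses (Sf : S0 mu_f (setX P) (objf P)) (Sg : S0 mu_g (setY P) (objg P)).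
Hypothesis sumf : 0 < mu_f -> subdiff_sum_rule (setX P) (objf P).
Hypothesis sumg : 0 < mu_g -> subdiff_sum_rule (setY P) (objg P).
Hypothesis step_size : forall k,
  2 * alpha c k ^+ 2 * (beta c k * opnorm (matA P) ^+ 2
                        + gamma c k * opnorm (matB P) ^+ 2)
  = gamma c k * beta c k * theta c k.

Let res k := residual P (itx it k) (ity it k).
Let feas k := feasible P (itx it k) (ity it k).
Let E := lyapunov P c it xs ys ls.

Let fN x : objf P x != -oo%E. Proof. by case: std => _ _ [[+ _] _ _] _. Qed.
Let gN y : objg P y != -oo%E. Proof. by case: std => _ _ _ [[+ _] _ _]. Qed.

Lemma feasibleS k : feas k.+1.
Proof. exact: (prox_algorithm_feasible fN gN k alg). Qed.

Lemma feasible_saddle : feasible P xs ys.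
Proof. exact: (saddle_point_feasible fN gN saddle (feasibleS 0)). Qed.

Lemma residual_saddle : residual P xs ys = 0.
Proof. exact: (saddle_point_residual saddle feasible_saddle). Qed.

Definition opt_value := fine (objf P xs) + fine (objg P ys).

(** Since [fine] sends infinite values to 0, this real version and [lyapunov_real] are meaningful
    only at feasible iterates. *)
Definition gap_real k :=
  fine (objf P (itx it k)) + fine (objg P (ity it k)) - opt_value + dot ls (res k).

Definition lyapunov_real k :=
  gap_real k + gamma c k / 2 * dot (itv it k - xs) (itv it k - xs)
  + beta c k / 2 * dot (itw it k - ys) (itw it k - ys)
  + theta c k / 2 * dot (itl it k - ls) (itl it k - ls).

Lemma lagrangian_saddle l : lagrangian P xs ys l = opt_value%:E.
Proof.
by rewrite (lagrangian_fin _ feasible_saddle) residual_saddle dot0r addr0.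
Qed.

Lemma gap_fin k : feas k -> gap P it xs ys ls k = (gap_real k)%:E.
Proof.
move=> Fk; rewrite /gap lagrangian_saddle (lagrangian_fin _ Fk) -EFinB.
by congr (_%:E); rewrite /gap_real addrAC.
Qed.

Lemma lyapunov_fin k : feas k -> E k = (lyapunov_real k)%:E.
Proof.
by move=> Fk; rewrite /E /lyapunov gap_fin// -!EFinD !sqr_enorm.
Qed.

Lemma gap_infty k : ~ feas k -> gap P it xs ys ls k = +oo%E.
Proof.
by move=> nF; rewrite /gap lagrangian_saddle (lagrangian_infty fN gN _ nF).
Qed.

Lemma lyapunov_infty k : ~ feas k -> E k = +oo%E.
Proof. by move=> nF; rewrite /E /lyapunov gap_infty. Qed.

Lemma gap_real_ge0 k : feas k -> 0 <= gap_real k.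
Proof.
move=> Fk; case: saddle => _ _ /(_ (itx it k) (ity it k) ls) [_].
rewrite lagrangian_saddle lagrangian_fin// lee_fin /gap_real; lra.
Qed.

Let primal_quad_ge0 k :
  0 <= gamma c k / 2 * dot (itv it k - xs) (itv it k - xs)
       + beta c k / 2 * dot (itw it k - ys) (itw it k - ys).
Proof.
have gk := gamma_gt0 f0 c_ok k; have bk := beta_gt0 g0 c_ok k.
by rewrite addr_ge0// mulr_ge0 ?dot_ge0// divr_ge0// ltW.
Qed.

Lemma gap_le_lyapunov k : gap_real k <= lyapunov_real k.
Proof.
have : 0 <= theta c k / 2 * dot (itl it k - ls) (itl it k - ls).
  by rewrite mulr_ge0 ?dot_ge0// divr_ge0// ltW// (theta_gt0 c_ok).
have := primal_quad_ge0 k; rewrite /lyapunov_real; lra.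
Qed.

Lemma dual_le_lyapunov k : feas k ->
  theta c k / 2 * dot (itl it k - ls) (itl it k - ls) <= lyapunov_real k.
Proof.
move=> /gap_real_ge0; have := primal_quad_ge0 k; rewrite /lyapunov_real; lra.
Qed.

(** Both summands on the left of the step size rule are nonnegative; dropping either one bounds the
    other block's coefficient by [gamma c k / 2] or [beta c k / 2]. *)
Lemma coupling_bound k x x' y y' :
  alpha c k ^+ 2 / (2 * theta c k)
    * dot (residual P x' y' - residual P x y) (residual P x' y' - residual P x y)
  <= gamma c k / 2 * dot (x' - x) (x' - x) + beta c k / 2 * dot (y' - y) (y' - y).
Proof.
have t0 := theta_gt0 c_ok k; have a0 := alpha_gt0 c_ok k.
have gk := gamma_gt0 f0 c_ok k; have bk := beta_gt0 g0 c_ok k.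
have hA : alpha c k ^+ 2 / theta c k * opnorm (matA P) ^+ 2 <= gamma c k / 2.
  rewrite mulrAC ler_pdivrMr// -(ler_pM2l bk).
  have := step_size k.
  have : 0 <= alpha c k ^+ 2 * (gamma c k * opnorm (matB P) ^+ 2).
    by rewrite mulr_ge0 ?sqr_ge0 // mulr_ge0 ?sqr_ge0 // ltW.
  nra.
have hB : alpha c k ^+ 2 / theta c k * opnorm (matB P) ^+ 2 <= beta c k / 2.
  rewrite mulrAC ler_pdivrMr// -(ler_pM2l gk).
  have := step_size k.
  have : 0 <= alpha c k ^+ 2 * (beta c k * opnorm (matA P) ^+ 2).
    by rewrite mulr_ge0 ?sqr_ge0 // mulr_ge0 ?sqr_ge0 // ltW.
  nra.
have q0 : 0 <= alpha c k ^+ 2 / (2 * theta c k).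
  by rewrite divr_ge0 ?sqr_ge0// mulr_ge0// ltW.
apply: le_trans (ler_wpM2l q0 (dot_residualB_le P x x' y y')) _.
have := ler_wpM2r (dot_ge0 (x' - x)) hA.
have := ler_wpM2r (dot_ge0 (y' - y)) hB.
have -> : alpha c k ^+ 2 / (2 * theta c k) = (alpha c k ^+ 2 / theta c k) / 2.
  by field; rewrite gt_eqF.
lra.
Qed.

Lemma lyapunov_descent k : feas k ->
  (1 + alpha c k) * lyapunov_real k.+1 <= lyapunov_real k.
Proof.
move=> Fk; have [Xk Yk fk gk] := Fk; have [Xk1 Yk1 fk1 gk1] := feasibleS k.
have [Xs Ys fxs gys] := feasible_saddle.
case: std => -[_ cX] [_ cY] [pf _ cf] [pg _ cg].
have a0 := alpha_gt0 c_ok k.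
have tk := theta_gt0 c_ok k.
have gak := gamma_gt0 f0 c_ok k; have bek := beta_gt0 g0 c_ok k.
case: alg => /(_ k) hlbar /(_ k) [px hv py hw hl].
have sf : 0 < alpha c k ^+ 2 / eta_f mu_f c k.
  by rewrite divr_gt0 ?exprn_gt0 ?(eta_f_gt0 f0 c_ok).
have sg : 0 < alpha c k ^+ 2 / eta_g mu_g c k.
  by rewrite divr_gt0 ?exprn_gt0 ?(eta_g_gt0 g0 c_ok).
have Vf := prox_strong_subgradient cX pf cf f0 Sf sumf sf px.
have Vg := prox_strong_subgradient cY pg cg g0 Sg sumg sg py.
rewrite (prox_multiplier _ _ a0 gak f0 hv) in Vf.
rewrite (prox_multiplier _ _ a0 bek g0 hw) in Vg.
have Df := block_descent a0 gak f0 hv (Vf _ Xk fk) (Vf _ Xs fxs).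
have Dg := block_descent a0 bek g0 hw (Vg _ Yk gk) (Vg _ Ys gys).
set ra := residual P (itv it k) (itw it k) in hlbar *.
set rb := residual P (itv it k.+1) (itw it k.+1) in hl *.
have := dual_ascent (alpha c k) (itl it k) ls ra rb (lt0r_neq0 tk).
rewrite /= -hl -hlbar => dual.
have coupling :=
  coupling_bound k (itv it k) (itv it k.+1) (itw it k) (itw it k.+1).
(* This supplies the change of the multiplier term [dot ls (res k)] in the gap. *)
have extrapolation : alpha c k * dot ls rb
    = (1 + alpha c k) * dot ls (res k.+1) - dot ls (res k).
  rewrite -dotZr /rb hv hw residual_extrapolation ?lt0r_neq0//.
  by rewrite dotDr dotNr dotZr.
(* The linear terms of the two block estimates combine, because the residual vanishes at the saddle
   point, and cancel the [lbar] term of [dual]. *)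
have multiplier : alpha c k * (dot ((matA P)^T *m lbar k.+1) (itv it k.+1 - xs)
    + dot ((matB P)^T *m lbar k.+1) (itw it k.+1 - ys))
    = alpha c k * dot (lbar k.+1) rb.
  by rewrite !dot_trmx -dotDr -residualB residual_saddle subr0.
have : 0 <= alpha c k ^+ 2 / (2 * theta c k) * dot ra ra.
  by rewrite mulr_ge0 ?dot_ge0 // divr_ge0 ?sqr_ge0// mulr_ge0// ltW.
rewrite /lyapunov_real !mulrDr !mulrA.
rewrite (thetaS c_ok) (gammaS c_ok) (betaS c_ok) /gap_real /opt_value.
move: Df Dg dual coupling extrapolation multiplier; rewrite -/ra -/rb; lra.
Qed.

(** * Bounds on the residual, the gap and the objective *)

Lemma lyapunov_rate k : feas 0 -> lyapunov_real k <= theta c k * lyapunov_real 0.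
Proof.
move=> F0; elim: k => [|k IH]; first by case: c_ok => ->; rewrite mul1r.
have Fk : feas k by case: (k) => // j; exact: feasibleS.
have a1 : 0 < 1 + alpha c k by rewrite addr_gt0 ?(alpha_gt0 c_ok).
rewrite -(ler_pM2l a1) mulrA (thetaS c_ok).
exact: le_trans (lyapunov_descent Fk) IH.
Qed.

(** By extrapolation [(1 + alpha c k) *: res k.+1 - res k] is [alpha c k *: rb], which is also
    [theta c k] times the multiplier increment. *)
Lemma residual_rescaled k : res k = theta c k *: (itl it k - itl it 0 + res 0).
Proof.
elim: k => [|k IH].
  by case: c_ok => ->; rewrite subrr add0r scale1r.
have a0 := alpha_gt0 c_ok k; have t0 := theta_gt0 c_ok k.
have a1 : 0 < 1 + alpha c k by rewrite addr_gt0.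
apply: (scalerI (lt0r_neq0 a1)); rewrite scalerA (thetaS c_ok).
case: alg => _ /(_ k) [_ hv _ hw ->].
have := residual_extrapolation P (itx it k) (itx it k.+1) (ity it k)
  (ity it k.+1) (lt0r_neq0 a0).
rewrite -hv -hw -/(res k) -/(res k.+1) => /eqP.
rewrite eq_sym subr_eq IH => /eqP ->.
move: (residual P (itv it k.+1) _) (res 0) => rb r0.
by apply/colP => i; rewrite !mxE; field; rewrite lt0r_neq0.
Qed.

Definition R0_real :=
  Num.sqrt (2 * lyapunov_real 0) + enorm (itl it 0 - ls) + enorm (res 0).

Lemma residual_rate k : feas 0 -> enorm (res k) <= theta c k * R0_real.
Proof.
move=> F0; have t0 := theta_gt0 c_ok k.
have Fk : feas k by case: (k) => // j; exact: feasibleS.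
rewrite residual_rescaled enormZ gtr0_norm// ler_pM2l//.
apply: le_trans (enormD _ _) _; rewrite lerD2r.
have -> : itl it k - itl it 0 = (itl it k - ls) - (itl it 0 - ls).
  by rewrite opprB addrA subrK.
apply: le_trans (enormD _ _) _; rewrite enormN lerD2r.
(* The dual term of the Lyapunov function carries the same factor [theta c k] as its decay bound;
   cancelling it bounds the squared multiplier error by [2 * lyapunov_real 0]. *)
apply: ler_wsqrtr; rewrite -(ler_pM2l t0).
have := le_trans (dual_le_lyapunov Fk) (lyapunov_rate k F0); lra.
Qed.

Lemma lyapunov_step k : (E k.+1 - E k <= - ((alpha c k)%:E * E k.+1))%E.
Proof.
rewrite (lyapunov_fin (feasibleS k)).
(* Infeasibility can occur only at [k = 0]; the left side is then [-oo]. *)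
have [Fk|nF] := pselect (feas k); last by rewrite lyapunov_infty// leNye.
rewrite lyapunov_fin// -EFinM -EFinB -EFinN lee_fin.
have := lyapunov_descent Fk; lra.
Qed.

Let E0_infty : ~ feas 0 -> calR0 P c it xs ys ls = +oo%E.
Proof.
by move=> nF; rewrite /calR0 -/E lyapunov_infty// mulry gtr0_sg// mul1e.
Qed.

Let E0_fin : feas 0 -> calR0 P c it xs ys ls = R0_real%:E.
Proof. by move=> F0; rewrite /calR0 -/E lyapunov_fin. Qed.

Lemma residual_bound k :
  ((enorm (res k))%:E <= (theta c k)%:E * calR0 P c it xs ys ls)%E.
Proof.
have [F0|nF] := pselect (feas 0).
  by rewrite E0_fin// -EFinM lee_fin; exact: residual_rate.
by rewrite E0_infty// gt0_muley ?leey// lte_fin (theta_gt0 c_ok).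
Qed.

Lemma gap_bound k : (gap P it xs ys ls k <= (theta c k)%:E * E 0%N)%E.
Proof.
have [F0|nF] := pselect (feas 0); last first.
  by rewrite lyapunov_infty// gt0_muley ?leey// lte_fin (theta_gt0 c_ok).
have Fk : feas k by case: (k) => // j; exact: feasibleS.
rewrite lyapunov_fin// gap_fin// -EFinM lee_fin.
exact: le_trans (gap_le_lyapunov k) (lyapunov_rate k F0).
Qed.

Lemma objective_bound k :
  (`| objF P (itx it k) (ity it k) - objF P xs ys |
     <= (theta c k)%:E
        * (E 0%N + (enorm ls)%:E * calR0 P c it xs ys ls))%E.
Proof.
have t0 := theta_gt0 c_ok k.
have [F0|nF] := pselect (feas 0); last first.
  rewrite (lyapunov_infty nF) addye ?gt0_muley ?leey ?lte_fin//.
  (* The second summand must not be [-oo]. It is nonnegative, also for [ls = 0], where [0 * +oo] is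
     0. *)
  by rewrite gt_eqF// (lt_le_trans ltNy0)// mule_ge0 ?lee_fin ?enorm_ge0// E0_infty.
have Fk : feas k by case: (k) => // j; exact: feasibleS.
have [_ _ fx gy] := Fk; have [_ _ fxs gys] := feasible_saddle.
rewrite E0_fin// lyapunov_fin// /objF.
rewrite -(fineK fx) -(fineK gy) -(fineK fxs) -(fineK gys).
rewrite -EFinM -!EFinD abse_EFin lee_fin.
have gap0 := gap_real_ge0 Fk.
have gapk := le_trans (gap_le_lyapunov k) (lyapunov_rate k F0).
have hl := norm_dot_le ls (res k).
have hr := ler_wpM2l (enorm_ge0 ls) (residual_rate k F0).
(* The gap and the residual are both already controlled, so the objective error is split into
   them. *)
have -> : fine (objf P (itx it k)) + fine (objg P (ity it k))
    - (fine (objf P xs) + fine (objg P ys)) = gap_real k - dot ls (res k).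
  by rewrite /gap_real /opt_value addrK.
apply: le_trans (ler_normB _ _) _; rewrite ger0_norm//.
by move: hl hr gapk; lra.
Qed.

End Convergence.

(** * The rate of theta *)

(* [rate_potential mu t] and [rate_scale mu t] describe one block through
   [t = theta_k]: the parameter [gamma_k] equals [gamma_0 * rate_scale mu_f t],
   and the potential is, up to a constant, a primitive of
   [(phi * rate_scale mu (1 / phi)) ^ (-1/2)] in [phi = 1 / t]. *)
Definition rate_scale (R : realType) (mu t : R) : R := if mu == 0 then t else 1.

Definition rate_potential (R : realType) (mu t : R) : R :=
  if mu == 0 then t^-1 else 3 * (Num.sqrt t)^-1.

Lemma rate_potential_ge0 (R : realType) (mu t : R) :
  0 < t -> 0 <= rate_potential mu t.
Proof.
move=> t0; rewrite /rate_potential; case: ifP => _.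
  by rewrite invr_ge0 ltW.
by rewrite mulr_ge0 // invr_ge0 sqrtr_ge0.
Qed.

(** For [mu = 0] this is an equality. Otherwise put [d = sqrt (1 + a)]: then [a = (d - 1) (d + 1)],
    and [a <= 1] gives [d + 1 <= 3], the constant in [rate_potential]. *)
Lemma rate_potential_increment (R : realType) (mu a t t' : R) :
  0 < a <= 1 -> 0 < t' -> (1 + a) * t' = t ->
  a / (Num.sqrt t * Num.sqrt (rate_scale mu t))
    <= rate_potential mu t' - rate_potential mu t.
Proof.
move=> /andP[a0 a1] t'0 ht.
have a10 : 0 < 1 + a by rewrite addr_gt0.
have t0 : 0 < t by rewrite -ht mulr_gt0.
rewrite /rate_scale /rate_potential; case: ifP => _.
  rewrite -expr2 sqr_sqrtr ?(ltW t0)// -ht le_eqVlt; apply/orP; left; apply/eqP.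
  by field; rewrite !gt_eqF.
rewrite sqrtr1 mulr1 -ht sqrtrM ?(ltW a10)//.
set s := Num.sqrt t'; have s0 : 0 < s by rewrite sqrtr_gt0.
set d := Num.sqrt (1 + a).
have d0 : 0 < d by rewrite sqrtr_gt0.
have d2 : d ^+ 2 = 1 + a by rewrite sqr_sqrtr// ltW.
have -> : 3 * s^-1 - 3 * (d * s)^-1 = 3 * (d - 1) / (d * s).
  by field; rewrite !gt_eqF.
rewrite ler_pM2r ?invr_gt0 ?mulr_gt0//.
have -> : a = (d - 1) * (d + 1) by rewrite -subr_sqr_1 d2; ring.
have d1 : 1 <= d by rewrite -sqrtr1 ler_wsqrtr// lerDl ltW.
nra.
Qed.

Definition rate_real (R : realType) (a g0 mu : R) (k : nat) : R :=
  let u := a / (Num.sqrt g0 * k%:R) in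
  if mu == 0 then u else Num.min u (a ^+ 2 / (mu * k%:R ^+ 2)).

Lemma rate_termE (R : realType) (a g0 mu : R) (k : nat) :
  rate_term a g0 mu k = (rate_real a g0 mu k)%:E.
Proof.
rewrite /rate_term /rate_real; case: ifP => _; last by rewrite EFin_min.
by apply/min_idPl; rewrite leey.
Qed.

Lemma rate_real_ge0 (R : realType) (a g0 mu : R) (k : nat) :
  0 <= a -> 0 <= mu -> 0 <= rate_real a g0 mu k.
Proof.
move=> a0 mu0; have u0 : 0 <= a / (Num.sqrt g0 * k%:R).
  by rewrite divr_ge0// mulr_ge0 ?sqrtr_ge0.
rewrite /rate_real; case: ifP => // _; rewrite le_min u0 /=.
by rewrite divr_ge0 ?sqr_ge0// mulr_ge0 ?sqr_ge0.
Qed.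

Lemma rate_potential_bound (R : realType) (a g0 mu t : R) (k : nat) :
  0 <= a -> 0 < g0 -> (mu != 0 -> g0 = mu) -> 0 < t <= 1 -> (1 <= k)%N ->
  k%:R <= 3 * (a / Num.sqrt g0 * rate_potential mu t) ->
  t <= 81 * rate_real a g0 mu k.
Proof.
move=> a0 g00 hmu /andP[t0 t1] k1.
have k0 : 0 < k%:R :> R by rewrite ltr0n.
have sg0 : 0 < Num.sqrt g0 by rewrite sqrtr_gt0.
rewrite /rate_potential /rate_real.
have -> : a / (Num.sqrt g0 * k%:R) = a / Num.sqrt g0 / k%:R.
  by field; rewrite !gt_eqF.
have u0 : 0 <= a / Num.sqrt g0 by rewrite divr_ge0// ltW.
case: eqVneq => [_|/hmu <-].
  rewrite mulrA ler_pdivlMr// => h.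
  rewrite mulrA ler_pdivlMr//; nra.
have -> : a ^+ 2 / (g0 * k%:R ^+ 2) = (a / Num.sqrt g0 / k%:R) ^+ 2.
  rewrite !exprMn !exprVn sqr_sqrtr ?ltW//; field; rewrite !gt_eqF//.
move: (a / Num.sqrt g0) u0 => u u0 h.
set s := Num.sqrt t in h.
have s0 : 0 < s by rewrite sqrtr_gt0.
have ts : t = s ^+ 2 by rewrite sqr_sqrtr ?ltW.
have s1 : s <= 1 by rewrite -sqrtr1 ler_wsqrtr.
pose z := u / k%:R.
have z0 : 0 <= z by rewrite divr_ge0// ltW.
have sz : s <= 9 * z.
  rewrite /z mulrA ler_pdivlMr//.
  move: h; rewrite !mulrA ler_pdivlMr//; lra.
(* From [s <= 9 * z], squaring gives [t <= 81 * z ^+ 2], while [s <= 1] gives [t <= s <= 9 * z], so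
   [81] serves both entries of the minimum. *)
rewrite -/z minr_pMr//; rewrite le_min ts; apply/andP; split; nra.
Qed.

(** For [mu = 0] the recurrence is that of [theta]; otherwise the initial value [mu] is its fixed
    point. *)
Lemma scaled_parameterE (R : realType) (mu_f mu_g mu : R) (c : params R)
    (g : nat -> R) (k : nat) :
  params_ok mu_f mu_g c ->
  (forall j, (1 + alpha c j) * g j.+1 = g j + alpha c j * mu) ->
  (mu != 0 -> g 0%N = mu) -> g k = g 0%N * rate_scale mu (theta c k).
Proof.
move=> c_ok gS hmu.
have a1 j : 1 + alpha c j != 0 by rewrite gt_eqF// addr_gt0 ?(alpha_gt0 c_ok).
rewrite /rate_scale; elim: k => [|k IH].
  by case: c_ok => ->; case: ifP; rewrite mulr1.
apply: (mulfI (a1 k)); rewrite gS; case: (eqVneq mu 0) IH hmu => [->|mu0] -> hmu.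
  by rewrite mulr0 addr0 mulrCA (thetaS c_ok).
by rewrite hmu//; ring.
Qed.

Section Rate.
Variables (R : realType) (mu_f mu_g a b : R) (c : params R).
Hypotheses (f0 : 0 <= mu_f) (g0 : 0 <= mu_g) (a0 : 0 <= a) (b0 : 0 <= b).
Hypothesis c_ok : params_ok mu_f mu_g c.
Hypotheses (hf : mu_f != 0 -> gamma c 0 = mu_f).
Hypotheses (hg : mu_g != 0 -> beta c 0 = mu_g).
Hypothesis step_size : forall k,
  2 * alpha c k ^+ 2 * (beta c k * a ^+ 2 + gamma c k * b ^+ 2)
  = gamma c k * beta c k * theta c k.
Hypothesis initial : gamma c 0 * beta c 0
  <= 2 * beta c 0 * a ^+ 2 + 2 * gamma c 0 * b ^+ 2.

Lemma theta_le1 k : theta c k <= 1.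
Proof.
elim: k => [|k IH]; first by case: c_ok => ->.
apply: le_trans IH; rewrite -(thetaS c_ok k) ler_peMl ?lerDl ?ltW//.
- exact: theta_gt0 c_ok _.
- exact: alpha_gt0 c_ok _.
Qed.

Let gammaE k : gamma c k = gamma c 0 * rate_scale mu_f (theta c k).
Proof. by apply: (scaled_parameterE _ c_ok) hf => j; exact: (gammaS c_ok). Qed.

Let betaE k : beta c k = beta c 0 * rate_scale mu_g (theta c k).
Proof. by apply: (scaled_parameterE _ c_ok) hg => j; exact: (betaS c_ok). Qed.

Let scale01 mu k : 0 < rate_scale mu (theta c k) <= 1.
Proof.
by rewrite /rate_scale; case: ifP => _; rewrite ?ltr01 ?lexx// theta_le1 (theta_gt0 c_ok).
Qed.

Let A := a / Num.sqrt (gamma c 0).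
Let B := b / Num.sqrt (beta c 0).

(** The step size rule divided by [gamma c k * beta c k], which separates the two blocks. *)
Let theta_split k : theta c k = 2 * alpha c k ^+ 2 *
  ((A / Num.sqrt (rate_scale mu_f (theta c k))) ^+ 2
   + (B / Num.sqrt (rate_scale mu_g (theta c k))) ^+ 2).
Proof.
have := step_size k; have /andP[sf _] := scale01 mu_f k.
have /andP[sg _] := scale01 mu_g k.
have gk := gamma_gt0 f0 c_ok 0; have bk := beta_gt0 g0 c_ok 0.
rewrite (gammaE k) (betaE k) !exprMn !exprVn !sqr_sqrtr ?ltW// => h.
apply: (mulfI (lt0r_neq0 (mulr_gt0 (mulr_gt0 gk sf) (mulr_gt0 bk sg)))).
rewrite [LHS](_ : _ = gamma c 0 * rate_scale mu_f (theta c k) *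
    (beta c 0 * rate_scale mu_g (theta c k)) * theta c k) // -h.
by field; rewrite !gt_eqF.
Qed.

(** The initial condition says [1 <= 2 * (A ^+ 2 + B ^+ 2)], and scales at most 1 only increase the
    right side. As [theta c k <= 1], [theta_split] then forces [alpha c k <= 1]. *)
Lemma alpha_le1 k : alpha c k <= 1.
Proof.
have ak := alpha_gt0 c_ok k.
have gk := gamma_gt0 f0 c_ok 0; have bk := beta_gt0 g0 c_ok 0.
have AB : 1 <= 2 * (A ^+ 2 + B ^+ 2).
  rewrite !exprMn !exprVn !sqr_sqrtr ?(ltW gk) ?(ltW bk)//.
  rewrite -(ler_pM2l (mulr_gt0 gk bk)) mulr1; apply: le_trans initial _.
  by rewrite le_eqVlt; apply/orP; left; apply/eqP; field; rewrite !gt_eqF.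
have scaled mu x : x ^+ 2 <= (x / Num.sqrt (rate_scale mu (theta c k))) ^+ 2.
  have /andP[s0 s1] := scale01 mu k.
  rewrite exprMn exprVn sqr_sqrtr ?(ltW s0)//.
  by rewrite ler_peMr ?sqr_ge0// invf_ge1.
have := theta_split k; have := theta_le1 k.
have := scaled mu_f A; have := scaled mu_g B.
set p := (A / _) ^+ 2; set q := (B / _) ^+ 2 => hq hp ht1 ht.
rewrite leNgt; apply/negP => ak1.
have : 1 < alpha c k ^+ 2 by rewrite expr_gt1 // ltW.
have pq1 : 1 <= 2 * (p + q) by lra.
have := ler_wpM2l (sqr_ge0 (alpha c k)) pq1; lra.
Qed.

Lemma rate_step k :
  1 <= 3 / 2 * (A * (rate_potential mu_f (theta c k.+1)
                     - rate_potential mu_f (theta c k))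
                + B * (rate_potential mu_g (theta c k.+1)
                       - rate_potential mu_g (theta c k))).
Proof.
have ak := alpha_gt0 c_ok k; have tk := theta_gt0 c_ok k.
have A0 : 0 <= A by rewrite divr_ge0 ?sqrtr_ge0.
have B0 : 0 <= B by rewrite divr_ge0 ?sqrtr_ge0.
have a01 : 0 < alpha c k <= 1 by rewrite ak alpha_le1.
have incr mu := rate_potential_increment mu a01 (theta_gt0 c_ok k.+1) (thetaS c_ok k).
have := ler_wpM2l A0 (incr mu_f); have := ler_wpM2l B0 (incr mu_g).
have := theta_split k.
set sf := Num.sqrt (rate_scale mu_f _); set sg := Num.sqrt (rate_scale mu_g _).
have sf0 : 0 < sf by rewrite sqrtr_gt0; case/andP: (scale01 mu_f k).
have sg0 : 0 < sg by rewrite sqrtr_gt0; case/andP: (scale01 mu_g k).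
set s := Num.sqrt (theta c k).
have s0 : 0 < s by rewrite sqrtr_gt0.
have p0 : 0 <= A / sf by rewrite divr_ge0// ltW.
have q0 : 0 <= B / sg by rewrite divr_ge0// ltW.
have -> : A * (alpha c k / (s * sf)) = alpha c k * (A / sf) / s.
  by field; rewrite !gt_eqF.
have -> : B * (alpha c k / (s * sg)) = alpha c k * (B / sg) / s.
  by field; rewrite !gt_eqF.
rewrite -[theta c k in LHS](sqr_sqrtr (ltW tk)) -/s.
move: (A / sf) (B / sg) p0 q0 => p q p0 q0 hs hB hA.
(* Square root of [theta_split], using [p^2 + q^2 <= (p + q)^2]; [3 / 2] is a rational upper bound
   of the square root of 2. *)
have : s <= 3 / 2 * (alpha c k * (p + q)).
  have pq0 : 0 <= 3 / 2 * (alpha c k * (p + q)).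
    by rewrite !mulr_ge0 ?addr_ge0// ltW.
  rewrite -(@ler_pXn2r _ 2) ?nnegrE ?(ltW s0)// hs.
  have := mulr_ge0 (sqr_ge0 (alpha c k)) (sqr_ge0 (p + q)).
  have := mulr_ge0 (sqr_ge0 (alpha c k)) (mulr_ge0 p0 q0).
  have := mulr_ge0 (sqr_ge0 (alpha c k)) (sqr_ge0 p).
  have := mulr_ge0 (sqr_ge0 (alpha c k)) (sqr_ge0 q).
  lra.
move=> hs1.
have : 1 <= 3 / 2 * (alpha c k * p / s + alpha c k * q / s).
  by rewrite -mulrDl -mulrDr mulrA ler_pdivlMr// mul1r.
move: hA hB; lra.
Qed.

Lemma theta_rate k : (1 <= k)%N ->
  theta c k <= 81 * (rate_real a (gamma c 0) mu_f k + rate_real b (beta c 0) mu_g k).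
Proof.
move=> k1.
have t01 : 0 < theta c k <= 1 by rewrite theta_le1 (theta_gt0 c_ok).
have A0 : 0 <= A by rewrite divr_ge0 ?sqrtr_ge0.
have B0 : 0 <= B by rewrite divr_ge0 ?sqrtr_ge0.
have hk : k%:R <= 3 / 2 * (A * rate_potential mu_f (theta c k)
                           + B * rate_potential mu_g (theta c k)).
  elim: (k) => [|j IH].
    by rewrite mulr_ge0 ?addr_ge0 ?mulr_ge0 ?rate_potential_ge0 ?(theta_gt0 c_ok).
  by have := rate_step j; rewrite -natr1; move: IH; lra.
have rf0 := rate_real_ge0 (gamma c 0) k a0 f0.
have rg0 := rate_real_ge0 (beta c 0) k b0 g0.
(* At least one of the two potentials accounts for a third of [k]. Its block alone yields the rate,
   and the other rate term is nonnegative. *)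
have [hA|hA] := leP k%:R (3 * (A * rate_potential mu_f (theta c k))).
  have := rate_potential_bound a0 (gamma_gt0 f0 c_ok 0) hf t01 k1 hA; lra.
have hB : k%:R <= 3 * (B * rate_potential mu_g (theta c k)) by lra.
have := rate_potential_bound b0 (beta_gt0 g0 c_ok 0) hg t01 k1 hB; lra.
Qed.

End Rate.

Theorem theorem3p3 (R : realType) :
  exists C : R, 0 < C /\
  forall (m n r : nat) (P : problem R m n r) (mu_f mu_g : R) (c : params R)
    (xs : 'cV[R]_m) (ys : 'cV[R]_n) (ls : 'cV[R]_r)
    (lbar : nat -> 'cV[R]_r) (it : iterates R m n r),
  standing P ->
  0 <= mu_f -> 0 <= mu_g ->
  params_ok mu_f mu_g c ->
  saddle_point P xs ys ls ->
  (lbar_explicit P c it lbar /\ schemeG P mu_f mu_g c lbar it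
     <-> prox_algorithm P mu_f mu_g c lbar it)
  /\
  (prox_algorithm P mu_f mu_g c lbar it ->
   S0 mu_f (setX P) (objf P) -> S0 mu_g (setY P) (objg P) ->
   (0 < mu_f -> subdiff_sum_rule (setX P) (objf P)) ->
   (0 < mu_g -> subdiff_sum_rule (setY P) (objg P)) ->
   (0 < mu_f -> gamma c 0 = mu_f) -> (0 < mu_g -> beta c 0 = mu_g) ->
   (forall k, 2 * alpha c k ^+ 2 * (beta c k * opnorm (matA P) ^+ 2
                                    + gamma c k * opnorm (matB P) ^+ 2)
              = gamma c k * beta c k * theta c k) ->
   let E := lyapunov P c it xs ys ls in
   [/\ forall k, (1 <= k)%N -> setX P (itx it k) /\ setY P (ity it k),
       forall k, (E k.+1 - E k <= - ((alpha c k)%:E * E k.+1))%E &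
       gamma c 0 * beta c 0 <= 2 * beta c 0 * opnorm (matA P) ^+ 2
                               + 2 * gamma c 0 * opnorm (matB P) ^+ 2 ->
       (forall k,
         [/\ ((enorm (residual P (itx it k) (ity it k)))%:E
                <= (theta c k)%:E * calR0 P c it xs ys ls)%E,
             (gap P it xs ys ls k <= (theta c k)%:E * E 0%N)%E &
             (`| objF P (itx it k) (ity it k) - objF P xs ys |
                <= (theta c k)%:E
                   * (E 0%N + (enorm ls)%:E * calR0 P c it xs ys ls))%E])
       /\
       (forall k, (1 <= k)%N ->
         ((theta c k)%:E
            <= C%:E * (rate_term (opnorm (matA P)) (gamma c 0) mu_f k
                       + rate_term (opnorm (matB P)) (beta c 0) mu_g k))%E)]).
Proof.
exists 81; split=> // m n r P mu_f mu_g c xs ys ls lbar it std f0 g0 c_ok saddle.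
have fN x : objf P x != -oo%E by case: std => _ _ [[+ _] _ _] _.
have gN y : objg P y != -oo%E by case: std => _ _ _ [[+ _] _ _].
split; first exact: (schemeG_prox_algorithm fN gN lbar it f0 g0 c_ok).
move=> alg Sf Sg sumf sumg hf hg step_size E; split.
- move=> [//|k] _.
  by have [] := prox_algorithm_feasible fN gN k alg.
- move=> k.
  exact: (lyapunov_step std f0 g0 c_ok saddle alg Sf Sg sumf sumg step_size).
move=> initial; split=> [k|k k1].
  split.
  + exact: (residual_bound std f0 g0 c_ok saddle alg Sf Sg sumf sumg step_size).
  + exact: (gap_bound std f0 g0 c_ok saddle alg Sf Sg sumf sumg step_size).
  + exact: (objective_bound std f0 g0 c_ok saddle alg Sf Sg sumf sumg step_size).
rewrite !rate_termE -EFinD -EFinM lee_fin.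
apply: (theta_rate f0 g0 _ _ c_ok) => //; try exact: opnorm_ge0.
- by move=> muf; apply: hf; rewrite lt_def muf.
- by move=> mug; apply: hg; rewrite lt_def mug.
Qed.
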